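(* Let $G$ be a graph with average degree $d$, minimum degree $\delta$ and $m$ edges, and let $k\ge 0$ be an integer. If $d\ge\delta\ge 1$, then $$\alpha_{k-reg}(L(G))\ge \frac{\beta\sqrt{m}-1}{\chi_k(L(G))},$$ where $\beta=\frac{\delta}{\sqrt{cd(cd-\delta)}}$ and $c=2d-2\delta+1$.
   Context: All graphs are finite, simple and undirected. $L(G)$ is the line graph of $G$. For a graph $H$, $D_i(H)$ denotes the set of vertices of degree $i$ in $H$. For an integer $k\ge 0$, a set $S\subseteq V(H)$ is $k$-independent if $H[S]$ has maximum degree at most $k$; a regular $k$-independent set is a $k$-independent set contained in some $D_i(H)$; $\alpha_{k-reg}(H)$ is the maximum cardinality of a regular $k$-independent set of $H$. The $k$-chromatic number $\chi_k(H)$ is the minimum number of colors in a coloring of $V(H)$ such that each color class induces a subgraph of maximum degree at most $k$. *)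

(* Defs.v *)
From HB Require Import structures.
From mathcomp Require Import all_boot all_order all_algebra.
Set Implicit Arguments.
Unset Strict Implicit.
Unset Printing Implicit Defensive.

Record sgraph := SGraph {
  vertex :> finType;
  adj : rel vertex;
  adj_sym : symmetric adj;
  adj_irrefl : irreflexive adj }.

Section GraphNotions.
Variable G : sgraph.

Definition deg (x : G) : nat := #|[set y | adj x y]|.

Definition edges : {set {set G}} :=
  [set [set p.1; p.2] | p : G * G & adj p.1 p.2].

Definition num_edges : nat := #|edges|.

Definition max_degree : nat := \max_(x : G) deg x.

(* Every degree is < #|G| when G is nonempty, so the default value #|G| never
   contributes; on the graph without vertices, min_degree is 0. *)
Definition min_degree : nat := \big[minn/#|G|]_(x : G) deg x.

Definition avg_degree (R : numFieldType) : R :=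
  ((\sum_(x : G) deg x)%N%:R / #|G|%:R)%R.

Definition degree_class (i : nat) : {set G} := [set x | deg x == i].

End GraphNotions.

Section Induced.
Variables (G : sgraph) (S : {set G}).

Definition induced_adj : rel {x : G | x \in S} :=
  fun x y => adj (val x) (val y).

Lemma induced_sym : symmetric induced_adj.
Proof. by move=> x y; exact: adj_sym. Qed.

Lemma induced_irrefl : irreflexive induced_adj.
Proof. by move=> x; exact: adj_irrefl. Qed.

Definition induced : sgraph := SGraph induced_sym induced_irrefl.

End Induced.

Section LineGraph.
Variable G : sgraph.

Definition line_adj : rel {A : {set G} | A \in edges G} :=
  fun A B => (A != B) && (val A :&: val B != set0).

Lemma line_sym : symmetric line_adj.
Proof. by move=> A B; rewrite /line_adj eq_sym setIC. Qed.

Lemma line_irrefl : irreflexive line_adj.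
Proof. by move=> A; rewrite /line_adj eqxx. Qed.

Definition line_graph : sgraph := SGraph line_sym line_irrefl.

End LineGraph.

Section KIndependence.
Variables (H : sgraph) (k : nat).

Definition k_independent (S : {set H}) : bool := max_degree (induced S) <= k.

(* Degrees never exceed #|H|, so bounding i loses nothing: see
   regular_k_independentP. *)
Definition regular_k_independent (S : {set H}) : bool :=
  k_independent S && [exists i : 'I_#|H|.+1, S \subset degree_class H i].

Lemma regular_k_independentP (S : {set H}) :
  reflect (k_independent S /\ exists i : nat, S \subset degree_class H i)
          (regular_k_independent S).
Proof.
apply: (iffP andP) => -[kS].
  by move=> /existsP [i Si]; split=> //; exists i.
move=> [i Si]; split=> //; apply/existsP.
have [->|[x xS]] := set_0Vmem S; first by exists ord0; rewrite sub0set.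
have lt_i : i < #|H|.+1.
  by move/subsetP: Si => /(_ _ xS); rewrite inE ltnS => /eqP <-; exact: max_card.
by exists (Ordinal lt_i).
Qed.

Definition alpha_k_reg : nat :=
  \max_(S : {set H} | regular_k_independent S) #|S|.

Definition k_colorable (n : nat) : bool :=
  [exists f : {ffun H -> 'I_n},
    [forall c : 'I_n, k_independent [set x | f x == c]]].

Lemma k_colorable_ex : exists n, k_colorable n.
Proof.
exists #|H|; apply/existsP; exists [ffun x => enum_rank x].
apply/forallP => c; apply/bigmax_leqP => x _.
suff -> : deg x = 0 by [].
apply/eqP; rewrite cards_eq0; apply/eqP.
apply/setP => y; rewrite !inE /= /induced_adj; move: (valP x) (valP y).
rewrite !inE !ffunE => /eqP xc /eqP yc.
by rewrite (enum_rank_inj (etrans xc (esym yc))) adj_irrefl.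
Qed.

Definition chi_k : nat := ex_minn k_colorable_ex.

End KIndependence.

(* Main.v *)
Require Import Defs.
From HB Require Import structures.
From mathcomp Require Import all_boot all_order all_algebra.
From mathcomp Require Import zify ring lra.
Import Order.TTheory GRing.Theory Num.Theory.

Set Implicit Arguments.
Unset Strict Implicit.
Unset Printing Implicit Defensive.

(** Write [n = #|G|], [q = \sum_u (deg u - delta)] and [r = alpha * chi].  In a
    [k]-colouring of [L(G)] each colour meets a degree class in a regular
    [k]-independent set, so no degree class of [L(G)] exceeds [r].  The degree
    of an edge [uv] in [L(G)] is [deg u + deg v - 2], so at most [r] edges of
    [G] join two given degrees.

    Let [D] be the set of vertices of degree [i] and [t] the number of other
    degrees.  Counting the arcs that leave [D], those that stay in [D] twice
    per edge, gives [i * #|D| <= (t + 2) * r].  The degrees being distinct,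
    [t (t - 1) <= 2 q], and a largest class has at least
    [n / c = n^2 / (n + 2 q)] vertices.  After squaring, the theorem says
    [y^2 <= T (r + 1)^2], where [y = delta n / c] and
    [T = 2 n (d - delta / c) = 2 q + 4 q delta / c].  If [n <= 2 q] this follows
    from the above.  If [2 q <= n], the vertices of minimum degree form a large
    enough class and [t (t + 1) <= 2 q], which leaves finitely many
    [(t, q, delta)] with [T < (t + 2)^2]; only [q = delta = 1] needs the further
    bound obtained by counting edges inside that class. *)

(** * Sums and level sets of a function into the natural numbers *)

Section Counting.
Variables (T : finType) (f : T -> nat).

(** By pigeonhole, [t + 1] distinct numbers that are at least [m] cannot all lie below [m + t].
    Removing one that reaches [m + t] gives the induction. *)
Lemma uniq_sum_lower (s : seq nat) m :
  uniq s -> all (leq m) s ->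
  size s * (size s).-1 + 2 * m * size s <= 2 * \sum_(j <- s) j.
Proof.
move Et: (size s) => t.
elim: t s Et => [|t IHt] s Et us sm; first by rewrite muln0.
have [j js jt] : exists2 j, j \in s & m + t <= j.
  apply/hasP; apply: contraT; rewrite -all_predC => /allP h.
  have /(uniq_leq_size us) : {subset s <= iota m t}.
    by move=> j js; have := h _ js; have := allP sm _ js;
       rewrite mem_iota /= -ltnNge => -> ->.
  by rewrite size_iota Et ltnn.
rewrite (perm_big _ (perm_to_rem js)) big_cons.
have := IHt (rem j s).
rewrite size_rem // Et rem_uniq // => /(_ erefl isT) h.
have {h} := h (introT allP (fun x xs => allP sm x (mem_rem xs))).
rewrite /=; case: t {IHt Et} jt => [|t] /= jt; nia.
Qed.

Lemma sum_undup_le (s : seq nat) : \sum_(j <- undup s) j <= \sum_(j <- s) j.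
Proof.
elim: s => //= x s IHs; rewrite [in leqRHS]big_cons.
by case: ifP => _; rewrite ?big_cons ?leq_add2l // (leq_trans IHs) ?leq_addl.
Qed.

Definition distinct_values (P : pred T) : seq nat := undup [seq f x | x <- enum P].

Lemma distinct_values_lower (P : pred T) m (t := size (distinct_values P)) :
  (forall x, P x -> m <= f x) ->
  t * t.-1 + 2 * m * t <= 2 * \sum_x f x.
Proof.
move=> Pm; apply: leq_trans (uniq_sum_lower (undup_uniq _) _) _.
  by apply/allP => j; rewrite mem_undup => /mapP[x]; rewrite mem_enum => /Pm + ->.
rewrite leq_mul2l /=; apply: leq_trans (sum_undup_le _) _.
by rewrite big_map big_enum /= [leqRHS](bigID P) /= leq_addr.
Qed.

(** Let [a] be the largest level size and [n = L * a + b] with [b < a]. At most [(j + 1) * a] points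
    have value at most [j], so the total shortfall of [f] below [L] is at most
    [a * L * (L + 1) / 2]. This bounds the sum of [f] from below, and the claim then holds with
    surplus at least [b * (a - b)]. *)
Lemma large_level_set (n := #|T|) :
  0 < n -> exists i, n * n <= #|[set x | f x == i]| * (2 * (\sum_x f x) + n).
Proof.
move=> n0.
have [x0 _] : exists x : T, x \in T by apply/card_gt0P.
pose lev j := #|[set x | f x == j]|.
have [y _ ymax] := arg_maxnP (fun y => lev (f y)) (erefl (predT x0)).
exists (f y); rewrite -/(lev _).
have {ymax} lev_le j : lev j <= lev (f y).
  have [E|[x]] := set_0Vmem [set x | f x == j]; first by rewrite /lev E cards0.
  by rewrite inE => /eqP <-; apply: ymax.
have a0 : 0 < lev (f y) by apply/card_gt0P; exists y; rewrite inE.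
move: (lev (f y)) lev_le a0 => a lev_le a0.
pose L := n %/ a; pose b := n %% a.
have nE : n = L * a + b := divn_eq n a.
have ba : b < a by rewrite ltn_mod.
have low j : #|[set x | f x <= j]| <= j.+1 * a.
  elim: j => [|j IHj].
    rewrite mul1n; apply: leq_trans (lev_le 0); apply: subset_leq_card.
    by apply/subsetP => x; rewrite !inE leqn0.
  rewrite mulSn addnC; apply: leq_trans (leq_add IHj (lev_le j.+1)).
  rewrite /lev -cardsUI; apply: leq_trans (leq_addr _ _); apply: subset_leq_card.
  by apply/subsetP => x; rewrite !inE leq_eqVlt orbC ltnS.
have defect : 2 * \sum_x (L - f x) <= L * L.+1 * a.
  have -> : \sum_x (L - f x) = \sum_(0 <= j < L) #|[set x | f x <= j]|.
    under [RHS]eq_bigr do rewrite -sum1dep_card big_mkcond /=.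
    rewrite exchange_big /=; apply: eq_bigr => x _.
    rewrite -big_mkcond /= sum1_count.
    elim: (L) => [|l IHl]; first by rewrite sub0n.
    rewrite -[l.+1]addn1 /index_iota subn0 iotaD count_cat /= addn0.
    by move: IHl; rewrite /index_iota subn0 => <-; rewrite add0n; lia.
  elim: (L) => [|l IHl]; first by rewrite big_geq.
  by rewrite big_nat_recr //= mulnDr; have := low l; nia.
have : n * L <= \sum_x f x + \sum_x (L - f x).
  rewrite -big_split /= /n -sum1_card big_distrl /=.
  by apply: leq_sum => x _; rewrite mul1n; lia.
move: (\sum_x f x) (\sum_x (L - f x)) defect => q p h1 h2; nia.
Qed.

End Counting.

(** * Colour classes and degree classes *)

Section ColourClasses.
Variables (H : sgraph) (k : nat).

Lemma k_independentS (A B : {set H}) :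
  A \subset B -> k_independent k B -> k_independent k A.
Proof.
move=> AB kB; apply/bigmax_leqP => x _.
have xB : val x \in B by apply: (subsetP AB); apply: valP.
apply: leq_trans (bigmax_leqP _ _ _ kB (Sub (val x) xB : induced B) isT).
rewrite /deg -(card_imset _ val_inj) -[leqRHS](card_imset _ val_inj).
apply: subset_leq_card; apply/subsetP => _ /imsetP[y + ->].
rewrite inE => xy; have yB : val y \in B by apply: (subsetP AB); apply: valP.
by apply/imsetP; exists (Sub (val y) yB); rewrite ?inE // /adj /= /induced_adj.
Qed.

Lemma degree_class_le (i : nat) :
  #|degree_class H i| <= alpha_k_reg H k * chi_k H k.
Proof.
rewrite /chi_k; case: ex_minnP => c /existsP[f /forallP kf] _.
have -> : #|degree_class H i| =
    \sum_(j < c) #|degree_class H i :&: [set x | f x == j]|.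
  rewrite -sum1_card (partition_big f predT) //=; apply: eq_bigr => j _.
  by rewrite -sum1_card; apply: eq_bigl => x; rewrite !inE.
rewrite mulnC -[X in X * _]card_ord -sum_nat_const; apply: leq_sum => j _.
set S := _ :&: _.
suff Sreg : regular_k_independent k S.
  exact: (@leq_bigmax_cond _ _ (fun S : {set H} => #|S|) S Sreg).
apply/regular_k_independentP; split; last by exists i; apply: subsetIl.
by apply: k_independentS (kf j); apply: subsetIr.
Qed.

End ColourClasses.

(** * Arcs, edges and degrees in the line graph *)

Section Edges.
Variable G : sgraph.
Implicit Types (u v w : G) (P : {set G * G}).

Definition ends (p : G * G) : {set G} := [set p.1; p.2].

Lemma ends_eq u v p : ends p = ends (u, v) -> p = (u, v) \/ p = (v, u).
Proof.
case: p => a b /setP E.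
have := E a; have := E b; have := E u; have := E v.
rewrite !inE !eqxx !orbT /=.
do ![case: eqP => [?|?] //=; subst]; by [left|right].
Qed.

Lemma ends_swap u v : ends (u, v) = ends (v, u).
Proof. exact: setUC. Qed.

Lemma edgesP (A : {set G}) :
  reflect (exists u v, adj u v /\ A = ends (u, v)) (A \in edges G).
Proof.
apply: (iffP imsetP) => [[[u v]]|[u [v [uv ->]]]].
  by rewrite inE => /= uv ->; exists u, v.
by exists (u, v); rewrite ?inE.
Qed.

Lemma card_le_ends P : #|P| <= 2 * #|ends @: P|.
Proof.
rewrite -sum1_card (partition_big_imset ends) /= mulnC -sum_nat_const.
apply: leq_sum => _ /imsetP[[u v] _ ->].
rewrite sum1dep_card; apply: leq_trans (_ : #|[set (u, v); (v, u)]| <= 2); last first.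
  by rewrite cards2; case: eqP.
apply: subset_leq_card; apply/subsetP => p; rewrite !inE => /andP[_ /eqP].
by case/ends_eq => ->; rewrite eqxx ?orbT.
Qed.

Definition arcs : {set G * G} := [set p | adj p.1 p.2].

Lemma card_arcs_from (P : pred G) :
  \sum_(u | P u) deg u = #|[set p in arcs | P p.1]|.
Proof.
rewrite -sum1dep_card.
under eq_bigr do rewrite /deg -sum1dep_card.
by rewrite pair_big_dep /=; apply: eq_bigl => -[u v]; rewrite !inE /= andbC.
Qed.

(** Each edge comes from two arcs, distinct because there are no loops. *)
Lemma handshake_le : 2 * num_edges G <= \sum_(x : G) deg x.
Proof.
have -> : \sum_(x : G) deg x = #|arcs|.
  rewrite (card_arcs_from predT); apply: eq_card => p.
  by rewrite !inE andbT.
have -> : num_edges G = #|ends @: arcs|.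
  by apply: eq_card => A; apply/imsetP/imsetP => -[p pa ->]; exists p;
     rewrite // !inE in pa *.
rewrite -[#|arcs|]sum1_card (partition_big_imset ends) /= mulnC -sum_nat_const.
apply: leq_sum => _ /imsetP[[u v] uv ->]; rewrite inE /= in uv.
rewrite sum1dep_card; apply: leq_trans (_ : 2 <= #|[set (u, v); (v, u)]|) _.
  rewrite cards2 xpair_eqE; case: eqP => //= E.
  by rewrite E adj_irrefl in uv.
apply: subset_leq_card; apply/subsetP => p; rewrite !inE.
by case/orP => /eqP -> /=; rewrite ?uv ?eqxx // adj_sym uv ends_swap eqxx.
Qed.

(** The neighbours of [uv] are the edges of the stars [inc u] and [inc v] other than [uv], and these
    stars share only [uv]. *)
Lemma deg_line_graph (A : line_graph G) u v :
  adj u v -> val A = ends (u, v) -> deg A = deg u + deg v - 2.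
Proof.
move=> uv AE.
pose inc w := [set ends (w, x) | x in [set x | adj w x]].
have card_inc w : #|inc w| = deg w.
  apply: card_in_imset => x y; rewrite !inE => wx wy.
  case/ends_eq => -[] // E1 E2; subst.
  by rewrite adj_irrefl in wx.
have neq : u != v by apply: contraL uv => /eqP ->; rewrite adj_irrefl.
have incI : inc u :&: inc v = [set ends (u, v)].
  apply/setP => B; rewrite !inE; apply/andP/eqP => [[]|->].
    case/imsetP=> x; rewrite inE => ux -> /imsetP[y]; rewrite inE => vy.
    case/ends_eq => -[E1 E2]; subst; first by rewrite eqxx in neq.
    by rewrite ends_swap.
  split; apply/imsetP; first by exists v; rewrite ?inE.
  by exists u; rewrite ?inE 1?adj_sym // ends_swap.
have -> : deg A = #|(inc u :|: inc v) :\ ends (u, v)|.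
  rewrite /deg -(card_imset _ val_inj); apply: eq_card => B.
  rewrite in_setD1 in_setU -AE; apply/imsetP/idP.
    case=> C; rewrite inE => /andP[AC /set0Pn[w]]; rewrite AE inE => /andP[wA wC] ->.
    apply/andP; split; first by apply: contraNneq AC => h; apply/eqP/val_inj; rewrite h.
    have /edgesP[x [y [xy CE]]] := valP C.
    have wi : val C \in inc w.
      apply/imsetP; move: wC; rewrite CE !inE => /orP[]/eqP ->.
        by exists y; rewrite ?inE.
      by exists x; rewrite ?inE 1?adj_sym // ends_swap.
    by move: wi; case/set2P: wA => /= -> ->; rewrite ?orbT.
  case/andP=> BA Buv.
  have [w wA wB] : exists2 w, w \in val A & B \in inc w.
    by case/orP: Buv => ?; [exists u | exists v]; rewrite // AE !inE eqxx ?orbT.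
  have {Buv} [x wx BE] : exists2 x, adj w x & B = ends (w, x).
    by case/imsetP: wB => x; rewrite inE => ? ->; exists x.
  have Be : B \in edges G by apply/edgesP; exists w, x.
  exists (Sub B Be) => //; rewrite inE /adj /= /line_adj; apply/andP; split.
    by apply: contraNneq BA => ->.
  by apply/set0Pn; exists w; rewrite inE wA /= BE !inE eqxx.
have := cardsU1 (ends (u, v)) ((inc u :|: inc v) :\ ends (u, v)).
have uvi : ends (u, v) \in inc u :|: inc v.
  have : ends (u, v) \in inc u :&: inc v by rewrite incI set11.
  by rewrite !in_setI in_setU => /andP[->].
rewrite setD1K // !inE eqxx /= cardsU incI cards1 !card_inc; lia.
Qed.

Lemma arcs_class_le r i j :
  (forall l, #|degree_class (line_graph G) l| <= r) ->
  #|ends @: [set p in arcs | deg p.1 == i & deg p.2 == j]| <= r.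
Proof.
move=> Hr; apply: leq_trans (Hr (i + j - 2)).
rewrite -[leqRHS](card_imset _ val_inj); apply: subset_leq_card.
apply/subsetP => _ /imsetP[[u v] + ->]; rewrite !inE /=.
case/and3P=> uv /eqP ui /eqP vj.
have e : ends (u, v) \in edges G by apply/edgesP; exists u, v.
apply/imsetP; exists (Sub (ends (u, v)) e) => //.
by rewrite inE (@deg_line_graph _ u v) // ui vj.
Qed.

(** For distinct degrees the condition orients each edge in only one way, so [ends] is injective
    here. *)
Lemma arcs_class_neq_le r i j :
  (forall l, #|degree_class (line_graph G) l| <= r) -> i != j ->
  #|[set p in arcs | deg p.1 == i & deg p.2 == j]| <= r.
Proof.
move=> Hr ij; rewrite -(@card_in_imset _ _ ends); first exact: arcs_class_le.
move=> [u v] [x y]; rewrite !inE /= => /and3P[_ /eqP ui /eqP vj] /and3P[_ /eqP xi /eqP yj].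
by case/ends_eq => // -[_ vx]; rewrite -xi -vj vx eqxx in ij.
Qed.

Lemma min_degree_le u : min_degree G <= deg u.
Proof.
rewrite /min_degree; have : u \in index_enum G by rewrite mem_index_enum.
elim: (index_enum G) => //= v s IHs; rewrite inE big_cons => /orP[/eqP <-|/IHs h].
  exact: geq_minl.
exact: leq_trans (geq_minr _ _) h.
Qed.

(** * Level sets of the excess [f u = deg u - dl] *)

Section Excess.
Variables (r dl : nat) (f : G -> nat).
Hypothesis class_le : forall i, #|degree_class (line_graph G) i| <= r.
Hypothesis degE : forall u, deg u = f u + dl.

Lemma arcs_level_split l (D := [set u | f u == l]) :
  (l + dl) * #|D| <= 2 * r + #|[set p in arcs | f p.1 == l & f p.2 != l]|.
Proof.
have -> : (l + dl) * #|D| = #|[set p in arcs | f p.1 == l]|.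
  rewrite -(card_arcs_from (fun u => f u == l)) -sum1dep_card big_distrr /=.
  by apply: eq_bigr => u /eqP ul; rewrite muln1 degE ul.
rewrite -(cardsID [set p | f p.2 == l]) leq_add //; last first.
  apply: subset_leq_card; apply/subsetP => p.
  by rewrite !inE => /andP[-> /andP[-> ->]].
apply: leq_trans (leq_mul (leqnn 2) (arcs_class_le (l + dl) (l + dl) class_le)).
apply: leq_trans (card_le_ends _); apply: subset_leq_card; apply/subsetP => p.
by rewrite !inE !degE !eqn_add2r -andbA.
Qed.

Lemma level_degree_le l (t := size (distinct_values f (fun u => f u != l))) :
  (l + dl) * #|[set u | f u == l]| <= t.+2 * r.
Proof.
apply: leq_trans (arcs_level_split l) _.
rewrite -(addn2 t) addnC mulnDl leq_add2r.
rewrite -sum1_card.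
(* Sort the arcs that leave the level by the excess of their head. *)
apply: (@leq_trans (\sum_(j <- distinct_values f (fun u => f u != l))
    #|[set p in arcs | f p.1 == l & (f p.2 != l) && (f p.2 == j)]|)).
  under [leqRHS]eq_bigr do rewrite -sum1dep_card big_mkcond /=.
  rewrite exchange_big /= big_mkcond /=; apply: leq_sum => p _.
  case: ifP => //; rewrite !inE => /and3P[pa pl pl'].
  rewrite pa pl pl' /= -big_mkcond /= sum1_count -has_count.
  apply/hasP; exists (f p.2) => //=.
  by rewrite mem_undup map_f // mem_enum.
rewrite /t -sum1_size big_distrl /= !big_seq; apply: leq_sum => j.
rewrite mem_undup => /mapP[v]; rewrite mem_enum => /= vl ->.
rewrite mul1n.
have ne : l + dl != f v + dl by rewrite eqn_add2r eq_sym.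
apply: leq_trans (arcs_class_neq_le class_le ne).
apply: subset_leq_card; apply/subsetP => p.
by rewrite !inE !degE !eqn_add2r => /and4P[-> -> _ ->].
Qed.

Lemma card_level0 : #|G| <= #|[set u | f u == 0]| + \sum_u f u.
Proof.
rewrite -(cardC [set u | f u == 0]) leq_add2l -sum1_card big_mkcond /=.
by apply: leq_sum => u _; rewrite !inE; case: (f u).
Qed.

(** Arcs leaving level 0, once reversed, start at vertices of positive excess, where
    [f u + dl <= (dl + 1) * f u]. Another [dl * \sum_u f u] pays for the vertices outside level
    0. *)
Lemma level0_degree_le : dl * #|G| <= 2 * r + (2 * dl).+1 * \sum_u f u.
Proof.
have h0 := card_level0; have := arcs_level_split 0; rewrite add0n => h1.
suff : #|[set p in arcs | f p.1 == 0 & f p.2 != 0]| <= dl.+1 * \sum_u f u by nia.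
apply: (@leq_trans #|[set p in arcs | f p.1 != 0]|).
  pose sw (p : G * G) := (p.2, p.1).
  have sw_inj : injective sw by move=> [a b] [c d] [-> ->].
  rewrite -(card_imset _ sw_inj); apply: subset_leq_card.
  apply/subsetP => _ /imsetP[[u v] + ->]; rewrite !inE /= => /and3P[uv _ ->].
  by rewrite adj_sym uv.
rewrite -(card_arcs_from (fun u => f u != 0)) big_distrr /= big_mkcond /=.
by apply: leq_sum => u _; rewrite degE; case: (f u) => //= x; nia.
Qed.

End Excess.

End Edges.

Local Open Scope ring_scope.

(** * Real inequalities behind the squared bound *)

Section Numeric.
Variable R : realFieldType.
Implicit Types (s r y z T u : R).

(** Here [u] is a lower estimate of the square root of [T]. Since [y / s <= r], the last hypothesis
    gives [y <= u * (1 + y / s) <= u * (r + 1)]. *)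
Lemma sqr_le_of_root s r y u T :
  0 < s -> 0 <= r -> 0 <= y -> 0 <= u -> y <= s * r ->
  u ^+ 2 <= T -> y * s <= u * (s + y) -> y ^+ 2 <= T * (r + 1) ^+ 2.
Proof.
move=> s0 r0 y0 u0 ysr uT H.
apply: (@le_trans _ _ (u ^+ 2 * (r + 1) ^+ 2)); last first.
  by apply: ler_wpM2r; rewrite ?sqr_ge0.
have r1 : 0 <= r + 1 by lra.
rewrite -exprMn ler_pXn2r // ?nnegrE ?mulr_ge0 // -(ler_pM2r s0).
apply: (le_trans H); rewrite -mulrA; apply: ler_wpM2l => //; nra.
Qed.

Lemma sqr_le_dense (t : nat) r y T :
  0 <= r -> 0 <= y -> y <= (t%:R + 2) * r ->
  t%:R * (t%:R - 1) + 2 * y <= T -> y ^+ 2 <= T * (r + 1) ^+ 2.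
Proof.
move=> r0 y0 ysr HT.
have t0 : 0 <= t%:R :> R by [].
have tt0 : 0 <= t%:R * (t%:R - 1) :> R.
  by case: t {t0 ysr HT} => [|t]; rewrite ?mul0r // mulr_ge0 // subr_ge0 ler1n.
set x : R := t%:R in ysr t0 tt0 HT *.
have T0 : 0 <= T by lra.
have s20 : 0 < (x + 2) ^+ 2 by rewrite exprn_gt0 // ltr_wpDl.
have y20 : 0 <= (x + 2 + y) ^+ 2 by apply: sqr_ge0.
rewrite -(ler_pM2r s20).
apply: (@le_trans _ _ (T * (x + 2 + y) ^+ 2)); last first.
  rewrite -mulrA -exprMn; apply: ler_wpM2l => //.
  by rewrite ler_pXn2r // ?nnegrE; nra.
apply: (le_trans _ (ler_wpM2r y20 HT)).
rewrite -subr_ge0.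
(* Completing the square in [y] in the cofactor of [y] leaves nonnegative terms, because
   [x * (x - 1) >= 0] for a natural number [x]. *)
have -> : (x * (x - 1) + 2 * y) * (x + 2 + y) ^+ 2 - y ^+ 2 * (x + 2) ^+ 2 =
  x * (x - 1) * (x + 2) ^+ 2 + y * (2 * (y + 1 - x / 4) ^+ 2
   + (2 * x * (x * (x - 1)) + 47/8 * x ^+ 2 + 5 * x + 6)) by field.
have h1 := sqr_ge0 (y + 1 - x / 4); have h2 := sqr_ge0 x.
by apply: addr_ge0; apply: mulr_ge0; rewrite ?(ltW s20) //; nra.
Qed.

Lemma sqr_le_sparse (n q dl t r : nat) (N := n%:R + 2 * q%:R : R)
    (z := dl%:R * n%:R / N) :
  (0 < q)%N -> (0 < dl)%N -> (2 * q <= n)%N -> (t * t.+1 <= 2 * q)%N ->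
  (dl * (n - q) <= t.+2 * r)%N -> (dl * n <= 2 * r + (2 * dl).+1 * q)%N ->
  (z * n%:R) ^+ 2 <= (2 * q%:R + 4 * q%:R * z) * (r%:R + 1) ^+ 2.
Proof.
move=> q0 dl0 qn tq Hr Hr2.
have nq : 2 * q%:R <= n%:R :> R by rewrite -natrM ler_nat.
have q0' : 1 <= q%:R :> R by rewrite ler1n.
have d0' : 1 <= dl%:R :> R by rewrite ler1n.
have N0 : 0 < N by rewrite /N; lra.
have zE : z * N = dl%:R * n%:R by rewrite /z divfK // gt_eqF.
have z0 : dl%:R <= 2 * z.
  by rewrite /z mulrA ler_pdivlMr // mulrCA ler_pM2l /N; lra.
have r0 : 0 <= r%:R :> R by [].
have y0 : 0 <= z * n%:R by apply: mulr_ge0 => //; lra.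
have ysr : z * n%:R <= (t%:R + 2) * r%:R.
  have : (dl * (n - q))%:R <= (t.+2 * r)%:R :> R by rewrite ler_nat.
  rewrite !natrM natrB; last by lia.
  rewrite -addn2 natrD; apply: le_trans.
  (* This is [n^2 <= (n - q) * (n + 2 * q)], equivalent to [2 * q <= n] as [q > 0]. *)
  rewrite -(ler_pM2r N0) mulrAC zE -!mulrA ler_pM2l ?ltr0n // /N; nra.
have s0 : 0 < t%:R + 2 :> R by rewrite ltr_wpDl.
rewrite /N in zE; move: (z) zE z0 y0 ysr => {z N N0} z zE z0 y0 ysr.
set T := 2 * _ + _.
have qzT : 4 * q%:R <= T by rewrite /T; nra.
have root u : 0 <= u -> u ^+ 2 <= T ->
    z * n%:R * (t%:R + 2) <= u * (t%:R + 2 + z * n%:R) ->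
    (z * n%:R) ^+ 2 <= T * (r%:R + 1) ^+ 2.
  by move=> u0; apply: sqr_le_of_root.
(* With [u = t + 2] the root condition is automatic. *)
have large : (t%:R + 2) ^+ 2 <= T ->
   (z * n%:R) ^+ 2 <= T * (r%:R + 1) ^+ 2.
  by move=> h; apply: (root _ _ h); nra.
have large_nat : ((t + 2) ^ 2 <= 4 * q)%N ->
   (z * n%:R) ^+ 2 <= T * (r%:R + 1) ^+ 2.
  move=> h; apply: large; apply: le_trans qzT.
  by move: h; rewrite -(ler_nat R) natrX natrD natrM.
have [t4|t3] := leqP 4 t; first by apply: large_nat; clear - tq t4; nia.
have n_le k : (n <= k)%N -> n%:R <= k%:R :> R by rewrite ler_nat.
have n_ge k : (k <= n)%N -> k%:R <= n%:R :> R by rewrite ler_nat.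
have d_ge k : (k <= dl)%N -> k%:R <= dl%:R :> R by rewrite ler_nat.
have N0 : 0 < n%:R + 2 * q%:R :> R by lra.
have z_ge a : a * (n%:R + 2 * q%:R) <= dl%:R * n%:R -> a <= z.
  by rewrite -zE ler_pM2r.
have z_le a : dl%:R * n%:R <= a * (n%:R + 2 * q%:R) -> z <= a.
  by rewrite -zE ler_pM2r.
have y_le a : z <= a -> z * n%:R <= a * n%:R by move=> ?; apply: ler_wpM2r.
have yd : z * n%:R <= dl%:R * n%:R by rewrite -zE; apply: ler_wpM2l; lra.
(* In most remaining cases, large [n] brings [z] close enough to [dl] for [large] to apply. For
   small [n], a rational [u] slightly below the square root of a lower bound of [T] suffices: when
   [u < t + 2], the root condition only asks that [z * n] be at most [u * (t + 2) / (t + 2 - u)]. *)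
have {t3} [E|[E|[E|E]]] : t = 0%N \/ t = 1%N \/ t = 2%N \/ t = 3%N by clear - t3; lia.
- by apply: large_nat; rewrite E; clear - q0; lia.
- have [q3|q3] := leqP 3 q.
    by apply: large_nat; rewrite E; clear - q3; lia.
  have {q3} [Eq|Eq] : q = 1%N \/ q = 2%N by clear - q0 q3; lia.
  + have [/d_ge ?|d4] := leqP 4 dl.
      by apply: large; rewrite /T E Eq; lra.
    have {d4} [Ed|[Ed|Ed]] : dl = 1%N \/ dl = 2%N \/ dl = 3%N by clear - dl0 d4; lia.
    (* For [q = dl = 1], [T] stays below 6, short of [(t + 2)^2 = 9] for every [n]. Here [T >= 4]
       and [z * n <= n - 1 <= 2 * (r + 1)]. *)
    * have : (n <= 2 * r + 3)%N by rewrite Ed Eq in Hr2; clear - Hr2; lia.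
      rewrite -(ler_nat R) natrD natrM => h.
      apply: (@le_trans _ _ (4 * (r%:R + 1) ^+ 2)); last first.
        by apply: ler_wpM2r; rewrite ?sqr_ge0 //; rewrite Eq in qzT; lra.
      have -> : 4 * (r%:R + 1) ^+ 2 = (2 * r%:R + 2) ^+ 2 :> R by ring.
      rewrite ler_pXn2r // ?nnegrE; [|lra].
      apply: (@le_trans _ _ (n%:R - 1)); last by lra.
      rewrite -(ler_pM2r N0) mulrAC zE Ed Eq; rewrite Eq in nq.
      set x : R := n%:R in nq *; nra.
    * rewrite Ed Eq in z_ge z0 yd.
      have [/n_ge h|/n_le h] := leqP 14 n.
        have := z_ge (7 / 4); rewrite /T in large.
        by move=> z1; apply: large; rewrite E Eq; lra.
      have [/n_ge h'|/n_le h'] := leqP 6 n.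
        have := z_ge (3 / 2); rewrite /T in root.
        by move=> z1; apply: (root (14 / 5)); rewrite ?E ?Eq; lra.
      by rewrite /T in root; apply: (root (12 / 5)); rewrite ?E ?Eq; lra.
    * rewrite Ed Eq in z_ge z0 yd.
      have [/n_ge h|/n_le h] := leqP 3 n.
        have := z_ge (9 / 5); rewrite /T in large.
        by move=> z1; apply: large; rewrite E Eq; lra.
      by rewrite /T in root; apply: (root (14 / 5)); rewrite ?E ?Eq; lra.
  + have [/d_ge ?|d2] := leqP 2 dl.
      by apply: large; rewrite /T E Eq; lra.
    have {d2} Ed : dl = 1%N by clear - dl0 d2; lia.
    rewrite Ed Eq in z_ge z0 yd.
    have [/n_ge h|/n_le h] := leqP 7 n.
      have := z_ge (5 / 8); rewrite /T in large.
      by move=> z1; apply: large; rewrite E Eq; lra.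
    by rewrite /T in root; apply: (root (14 / 5)); rewrite ?E ?Eq; lra.
- have [q4|q4] := leqP 4 q.
    by apply: large_nat; rewrite E; clear - q4; lia.
  have {q4} Eq : q = 3%N by rewrite E in tq; clear - tq q4; lia.
  have [/d_ge ?|d2] := leqP 2 dl.
    by apply: large; rewrite /T E Eq; lra.
  have {d2} Ed : dl = 1%N by clear - dl0 d2; lia.
  rewrite Ed Eq in z_ge z_le z0 yd.
  have [/n_ge h|/n_le h] := leqP 30 n.
    have := z_ge (5 / 6); rewrite /T in large.
    by move=> z1; apply: large; rewrite E Eq; lra.
  (* [z * n <= n] is too weak near [n = 30]; at that threshold [z] is exactly [5 / 6] and [T] is
     16. *)
  have /y_le z56 : z <= 5 / 6 by apply: z_le; lra.
  by rewrite /T in root; apply: (root (346 / 100)); rewrite ?E ?Eq; lra.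
- have [q7|q7] := leqP 7 q.
    by apply: large_nat; rewrite E; clear - q7; lia.
  have {q7} Eq : q = 6%N by rewrite E in tq; clear - tq q7; lia.
  have [/d_ge ?|d2] := leqP 2 dl.
    by apply: large; rewrite /T E Eq; lra.
  have {d2} Ed : dl = 1%N by clear - dl0 d2; lia.
  rewrite Ed Eq in z_ge z0 yd.
  have [/n_ge h|/n_le h] := leqP 15 n.
    have := z_ge (13 / 24); rewrite /T in large.
    by move=> z1; apply: large; rewrite E Eq; lra.
  by rewrite /T in root; apply: (root (48 / 10)); rewrite ?E ?Eq; lra.
Qed.

End Numeric.

(** * The squared bound for a graph, with [z] standing for [delta / c] *)

Section LineGraphBound.
Variables (R : realFieldType) (G : sgraph) (r : nat).
Hypothesis class_le : forall i, (#|degree_class (line_graph G) i| <= r)%N.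

Let n := #|G|.
Let dl := min_degree G.
Let q := (\sum_(u : G) (deg u - dl))%N.

Lemma sum_deg : (\sum_(u : G) deg u = dl * n + q)%N.
Proof.
rewrite /n mulnC -sum_nat_const -big_split /=; apply: eq_bigr => u _.
by rewrite subnKC // min_degree_le.
Qed.

Lemma degree_class_sqr_bound (z := dl%:R * n%:R / (n%:R + 2 * q%:R) : R) :
  (0 < n)%N -> (0 < dl)%N -> (0 < q)%N ->
  (z * n%:R) ^+ 2 <= (2 * q%:R + 4 * q%:R * z) * (r%:R + 1) ^+ 2.
Proof.
move=> n0 dl0 q0; pose f (u : G) := (deg u - dl)%N.
have degE u : deg u = (f u + dl)%N by rewrite subnK // min_degree_le.
have [qn|nq] := leqP (2 * q) n.
  have h1 := card_level0 f; have := level_degree_le class_le degE 0.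
  have pos u : f u != 0%N -> (0 < f u)%N by rewrite lt0n.
  (* Nonzero excesses are at least 1, which improves [t * (t - 1)] to [t * (t + 1)]. *)
  have := @distinct_values_lower _ f (fun u => f u != 0%N) 1 pos.
  rewrite add0n -/n in h1 *; set t := size _ => h2 h3.
  apply: (@sqr_le_sparse _ _ _ _ t) => //.
  - by move: h2; rewrite /= -/q; case: (t) => //= t'; clear; nia.
  - apply: leq_trans h3; rewrite leq_mul2l; apply/orP; right.
    by rewrite leq_subLR addnC.
  - exact: level0_degree_le class_le degE.
have [l hl] := large_level_set f n0.
have := level_degree_le class_le degE l.
have := @distinct_values_lower _ f (fun u => f u != l) 0 (fun _ _ => isT).
set t := size _; rewrite muln0 mul0n addn0 -/q -/n in hl * => h2 h3.
have N0 : 0 < n%:R + 2 * q%:R :> R by rewrite ltr_pwDl ?ltr0n // mulr_ge0.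
have z0 : 0 <= z by rewrite divr_ge0 ?mulr_ge0 // ltW.
apply: (@sqr_le_dense _ t) => //; first by rewrite mulr_ge0.
  rewrite /z mulrAC ler_pdivrMr //.
  have : (dl * n * n <= (t + 2) * r * (n + 2 * q))%N.
    rewrite -mulnA; apply: leq_trans (leq_mul (leqnn dl) hl) _.
    rewrite mulnA addnC addn2 leq_mul2r; apply/orP; right.
    apply: leq_trans h3; by rewrite leq_mul2r leq_addl orbT.
  by rewrite -(ler_nat R) !(natrM, natrD).
have t2 : t%:R * (t%:R - 1) <= 2 * q%:R :> R.
  rewrite -(ler_nat R) !natrM in h2; apply: le_trans h2.
  by case: (t) => [|t']; rewrite ?mul0r // -natr1 addrK.
have nq' : n%:R <= 2 * q%:R :> R by rewrite -natrM ler_nat ltnW.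
by apply: lerD => //; nra.
Qed.

End LineGraphBound.

(** * From the squared bound to the stated inequality *)

Theorem theorem4p2 (R : rcfType) (G : sgraph) (k : nat) :
  let d : R := avg_degree G R in
  let delta : R := (min_degree G)%:R in
  let m : R := (num_edges G)%:R in
  let c : R := 2 * d - 2 * delta + 1 in
  let beta : R := delta / Num.sqrt (c * d * (c * d - delta)) in
  delta <= d -> 1 <= delta ->
  (alpha_k_reg (line_graph G) k)%:R >=
    (beta * Num.sqrt m - 1) / (chi_k (line_graph G) k)%:R.
Proof.
move=> d delta m c beta _; rewrite ler1n => dl0.
(* Division by zero yields 0, so the bound is trivial here. *)
have [->|chi0] := posnP (chi_k (line_graph G) k); first by rewrite invr0 mulr0.
rewrite ler_pdivrMr ?ltr0n // -natrM lerBlDr.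
set r := (_ * _)%N.
have class_le i : (#|degree_class (line_graph G) i| <= r)%N.
  exact: degree_class_le.
have n0 : (0 < #|G|)%N.
  rewrite lt0n; apply: contraL dl0 => /eqP E.
  by rewrite /min_degree big_pred0 ?E // => x; have := fintype0 x E.
pose q := (\sum_(u : G) (deg u - min_degree G))%N.
pose n := #|G|.
have n0' : 0 < n%:R :> R by rewrite ltr0n.
have n0'' : n%:R != 0 :> R by rewrite gt_eqF.
have dE : d = delta + q%:R / n%:R.
  by rewrite /d /avg_degree sum_deg natrD natrM mulrDl mulfK.
have cE : c = (n%:R + 2 * q%:R) / n%:R by rewrite /c dE; field.
have cdE : c * d - delta = q%:R * (n%:R + 2 * q%:R + 2 * delta * n%:R) / n%:R ^+ 2.
  by rewrite cE dE; field.
have r1 : 0 <= r%:R + 1 :> R by rewrite addr_ge0.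
(* In the regular case [c * d = delta], so [beta] is a quotient by 0, hence 0. *)
have [q0|q0] := posnP q.
  by rewrite /beta cdE q0 !mul0r mulr0 sqrtr0 invr0 mulr0 mul0r.
have := degree_class_sqr_bound R class_le n0 dl0 q0.
rewrite -/n -/q -/delta; set N := n%:R + 2 * q%:R in cE cdE * => bound.
have q0' : 0 < q%:R :> R by rewrite ltr0n.
have dl0' : 0 < delta by rewrite ltr0n.
have N0 : 0 < N by rewrite /N; lra.
have d0 : 0 < d by rewrite dE ltr_pwDl // divr_ge0.
have c0 : 0 < c by rewrite cE divr_gt0.
have m_le : 2 * m <= n%:R * d.
  by rewrite /d /avg_degree mulrCA divff // mulr1 -natrM ler_nat handshake_le.
have cd0 : 0 < c * d * (c * d - delta).
  rewrite mulr_gt0 ?(mulr_gt0 c0) // cdE divr_gt0 ?exprn_gt0 // mulr_gt0 //.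
  by rewrite addr_gt0 // !mulr_gt0.
have b0 : 0 <= beta * Num.sqrt m.
  by rewrite mulr_ge0 ?sqrtr_ge0 // divr_ge0 ?sqrtr_ge0 ?ltW.
rewrite -(ler_pXn2r (n := 2)) // ?nnegrE //.
rewrite /beta !exprMn exprVn (sqr_sqrtr (ltW cd0)) sqr_sqrtr //.
rewrite mulrAC ler_pdivrMr //.
(* The scaling that turns [T] into [c * d * (c * d - delta)] and [y ^ 2] into
   [delta ^ 2 * n * d / 2], which is at least [delta ^ 2 * m]. *)
pose w := N ^+ 2 * d / (2 * n%:R ^+ 3).
have w0 : 0 <= w.
  by apply: divr_ge0; apply: mulr_ge0; rewrite ?sqr_ge0 ?exprn_ge0 ?(ltW d0).
have N0' : N != 0 by rewrite gt_eqF.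
apply: (@le_trans _ _ ((delta * n%:R / N * n%:R) ^+ 2 * w)).
  have -> : (delta * n%:R / N * n%:R) ^+ 2 * w = delta ^+ 2 * (n%:R * d / 2).
    by rewrite /w; field; rewrite n0''.
  by apply: ler_wpM2l; rewrite ?sqr_ge0 //; lra.
apply: (le_trans (ler_wpM2r w0 bound)); rewrite le_eqVlt; apply/orP; left.
by apply/eqP; rewrite cdE cE /w; field; rewrite n0''.
Qed.
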